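(* Suppose that $\mathcal{Q}$ is convex and that for all $d\in\mathcal{D}$ the cost function $C(q,d)$ is convex in $q$. Suppose that there is a re-parametrization of $\boldsymbol y\in\mathcal{Y}$ as $(\hat\theta,\boldsymbol y|\hat\theta)\in\Theta\times\mathcal{D}^{N-o}$, where $\boldsymbol y|\hat\theta$ denotes some parametrization of the fibre $\{\boldsymbol y:\hat\theta(\boldsymbol y)=\hat\theta\}$ for given $\hat\theta$, and that the Jacobian $J(\hat\theta,\boldsymbol y|\hat\theta)$ of this change of variables exists and is non-negative for all $\hat\theta\in\Theta$ and $\boldsymbol y|\hat\theta\in\mathcal{D}^{N-o}$. Let $u$ be a localization and let $$\beth(q,\hat\theta) := \int_{\Theta}\phi(q;\theta)\,g_1(\hat\theta,\theta)\,u(\theta)\,d\theta .$$ (i) If $\beth(\cdot,\hat\theta)$ is differentiable for every $\hat\theta\in\Theta$, then an MLE-sufficient prescriptive solution $q_{\mathrm{OVP}}$ is out-of-sample locally optimal about $u$ if $q=q_{\mathrm{OVP}}(\hat\theta)$ satisfies $$\frac{\partial\beth}{\partial q}(q,\hat\theta)=0\qquad\text{for all }\hat\theta\in\Theta.$$ (ii) If furthermore $\phi(\cdot;\theta)$ is differentiable for every $\theta\in\Theta$, then the condition in (i) is equivalent to $$\int_\Theta\frac{\partial\phi}{\partial q}(q;\theta)\,g_1(\hat\theta,\theta)\,u(\theta)\,d\theta=0\qquad\text{for all }\hat\theta\in\Theta .$$ Moreover, the left-hand side of this last equation is monotone in $q$ for each $\hat\theta\in\Theta$, and thus solving the equation reduces,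 for every $\hat\theta\in\Theta$, to a bisection search problem for $q(\hat\theta)$ (finding a zero of a monotone function of the single real variable $q$).
   Context: Setting. $\mathcal{Q}\subseteq\mathbb{R}$ is the feasible set of decisions $q$. The uncertain variable $d$ takes values in an outcome space $\mathcal{D}$ (with reference measure written $dd$), and $C(q,d)$ is a real-valued cost function. The hypothesis set is a family of probability densities $\{f(\cdot;\theta):\theta\in\Theta\}$ on $\mathcal{D}$ with $\Theta\subseteq\mathbb{R}^o$. The expected cost is $\phi(q;\theta):=\int_{\mathcal{D}}C(q,d)f(d;\theta)\,dd$. Data. A data set of size $N$ is $\boldsymbol y=(y_1,\dots,y_N)\in\mathcal{Y}:=\mathcal{D}^N$, consisting of i.i.d. samples from $f(\cdot;\theta)$, with joint density $g(\boldsymbol y;\theta):=\prod_{n=1}^N f(y_n;\theta)$. A prescriptive solution is a function $\boldsymbol y\mapsto q(\boldsymbol y)$ from $\mathcal{Y}$ to $\mathbb{R}$, feasible in the sense that $q(\boldsymbol y)\in\mathcal{Q}$, with no explicit dependence on $\theta$. Localization and performance. A localization $u$ is a probability density on $\Theta$. The expected out-of-sample performance of $q(\cdot)$ with respect to $u$ is $$\Psi[q(\cdot);u]:=\int_\Theta\int_{\mathcal{Y}}\int_{\mathcal{D}}C(q(\boldsymbol y),d)\,f(d;\theta)\,g(\boldsymbol y;\theta)\,u(\theta)\,dd\,d\boldsymbol y\,d\theta .$$ A prescriptive solution is out-of-sample locally optimal about $u$ if it minimizes $\Psi[\,\cdot\,;u]$ over prescriptive solutions. Sufficient statistic. $\hat\theta:\mathcal{Y}\to\Theta$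 is the maximum likelihood estimator, $\hat\theta(\boldsymbol y)$ maximizing $g(\boldsymbol y;\theta)$ over $\theta\in\Theta$. It is assumed to be a sufficient statistic, so there are non-negative functions $g_0,g_1$ with $g(\boldsymbol y;\theta)=g_0(\boldsymbol y)\,g_1(\hat\theta(\boldsymbol y),\theta)$ for all $\boldsymbol y\in\mathcal{Y}$, $\theta\in\Theta$. A prescriptive solution is MLE-sufficient if it depends on $\boldsymbol y$ only through $\hat\theta(\boldsymbol y)$, i.e. it can be written $q(\hat\theta(\boldsymbol y))$ for a function $q(\hat\theta)$ of $\hat\theta\in\Theta$. Change of variables. The re-parametrization with Jacobian $J$ means that $$\int_{\mathcal{Y}}h(\boldsymbol y)\,d\boldsymbol y=\int_\Theta\int_{\{\boldsymbol y:\hat\theta(\boldsymbol y)=\hat\theta\}}h(\hat\theta,\boldsymbol y|\hat\theta)\,J(\hat\theta,\boldsymbol y|\hat\theta)\,d(\boldsymbol y|\hat\theta)\,d\hat\theta,$$ where $h(\hat\theta,\boldsymbol y|\hat\theta)$ denotes $h$ in the new coordinates. Convention. All functions are measurable, and the integrals written are assumed to be well defined (finite for $\beth$ and $\phi$) with interchange of the order of integration permitted. *)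

(* Defs.v *)
From HB Require Import structures.
From mathcomp Require Import all_boot all_order all_algebra.
From mathcomp Require Import all_classical all_reals all_analysis.
From mathcomp Require Import measurable_realfun.

Set Implicit Arguments.
Unset Strict Implicit.
Unset Printing Implicit Defensive.

Import Order.TTheory GRing.Theory Num.Theory.
Import numFieldNormedType.Exports.

Local Open Scope classical_set_scope.
Local Open Scope ring_scope.

(** * Product measures on tuples

    The library equips [n.-tuple T] with the product sigma-algebra, but not with
    the n-fold product of a sigma-finite measure. *)

Section tuple_cons_measure.
Context d (T : measurableType d) (R : realType) (n : nat).
Variables (mu : {sigma_finite_measure set T -> \bar R})
  (nu : {sigma_finite_measure set (n.-tuple T) -> \bar R}).

Definition tuple_cons (p : T * n.-tuple T) : n.+1.-tuple T :=
  [tuple of p.1 :: p.2].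

Let measurable_tuple_cons : measurable_fun [set: T * n.-tuple T] tuple_cons.
Proof. by apply: measurable_cons. Qed.

Definition tuple_cons_measure : set (n.+1.-tuple T) -> \bar R :=
  pushforward (mu \x nu)%E tuple_cons.

Let mpre A : measurable A -> measurable (tuple_cons @^-1` A).
Proof. by move=> mA; rewrite -[X in measurable X]setTI; apply: measurable_tuple_cons. Qed.

Let tcm0 : tuple_cons_measure set0 = 0%E.
Proof. by rewrite /tuple_cons_measure /pushforward preimage_set0 measure0. Qed.

Let tcm_ge0 A : (0 <= tuple_cons_measure A)%E.
Proof. exact: measure_ge0. Qed.

Let tcm_sigma_additive : semi_sigma_additive tuple_cons_measure.
Proof.
move=> F mF tF mUF; rewrite /tuple_cons_measure /pushforward preimage_bigcup.
apply: measure_semi_sigma_additive.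
- by move=> i; exact: mpre.
- apply/trivIsetP => /= i j _ _ ij; rewrite -preimage_setI.
  by move/trivIsetP : tF => /(_ _ _ _ _ ij) ->//; rewrite preimage_set0.
- by rewrite -preimage_bigcup; exact: mpre.
Qed.

HB.instance Definition _ := isMeasure.Build _ _ _ tuple_cons_measure
  tcm0 tcm_ge0 tcm_sigma_additive.

Let tcm_sigma_finite : sigma_finite setT tuple_cons_measure.
Proof.
have /sigma_finiteP[F [TF ndF Foo]] := sigma_finiteT mu.
have /sigma_finiteP[G [TG ndG Goo]] := sigma_finiteT nu.
pose hd (y : n.+1.-tuple T) := thead y.
pose tl (y : n.+1.-tuple T) : n.-tuple T := [tuple of behead y].
exists (fun k => hd @^-1` F k `&` tl @^-1` G k).
  apply/seteqP; split => // y _.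
  have [i _ Fi] : (\bigcup_i F i) (hd y) by rewrite -TF.
  have [j _ Gj] : (\bigcup_i G i) (tl y) by rewrite -TG.
  exists (maxn i j) => //; split => /=.
  - by move: Fi; apply/subsetPset/ndF/leq_maxl.
  - by move: Gj; apply/subsetPset/ndG/leq_maxr.
move=> k; have [mF Fk] := Foo k; have [mG Gk] := Goo k; split.
  apply: measurableI; rewrite -[X in measurable X]setTI.
  - exact: measurable_tnth.
  - exact: measurable_behead.
rewrite /tuple_cons_measure /pushforward (_ : _ @^-1` _ = F k `*` G k).
  by rewrite product_measure1E// lte_mul_pinfty// ge0_fin_numE.
apply/seteqP; split => -[x t] /=; rewrite /hd /tl /tuple_cons /= theadE.
  by rewrite (_ : [tuple of _] = t)//; apply/val_inj.
by rewrite (_ : [tuple of _] = t)//; apply/val_inj.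
Qed.

HB.instance Definition _ := Measure_isSigmaFinite.Build _ _ _ tuple_cons_measure
  tcm_sigma_finite.

End tuple_cons_measure.

Fixpoint power_measure d (T : measurableType d) (R : realType)
    (mu : {sigma_finite_measure set T -> \bar R}) (n : nat) :
    {sigma_finite_measure set (n.-tuple T) -> \bar R} :=
  match n with
  | 0 => dirac ([tuple] : 0.-tuple T)
  | m.+1 => tuple_cons_measure mu (power_measure mu m)
  end.

Lemma power_measure_box d (T : measurableType d) (R : realType)
    (mu : {sigma_finite_measure set T -> \bar R}) (n : nat)
    (A : 'I_n -> set T) : (forall i, measurable (A i)) ->
  measurable [set y : n.-tuple T | forall i, A i (tnth y i)] /\
  power_measure mu n [set y | forall i, A i (tnth y i)]
  = (\prod_(i < n) mu (A i))%E.
Proof.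
have mbox m (B : 'I_m -> set T) : (forall i, measurable (B i)) ->
    measurable [set y : m.-tuple T | forall i, B i (tnth y i)].
  move=> mB; rewrite (_ : mkset _ =
      \bigcap_(i in [set: 'I_m]) ((@tnth m T)^~ i @^-1` B i)).
    apply: fin_bigcap_measurable => [|i _]; first exact: finite_finset.
    rewrite -[X in measurable X]setTI.
    exact: measurable_tnth.
  by apply/seteqP; split=> y /= H i; [move=> _; exact: H|exact: (H i I)].
move=> mA; split; first exact: mbox.
elim: n => [|n IH] in A mA *.
  rewrite big_ord0 /= diracE mem_set// => i; by case: i.
rewrite big_ord_recl -IH; last by move=> i; exact: mA.
rewrite -product_measure1E//; last first.
  exact: (mbox n (fun i => A (lift ord0 i)) (fun i => mA _)).
rewrite /= /tuple_cons_measure /pushforward; congr (_ _).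
apply/seteqP; split=> [[x t]/= H|[x t]/= [H0 H] i].
  split; first exact: (H ord0).
  by move=> i; have := H (lift ord0 i); rewrite tnthS.
by case: (unliftP ord0 i) => [j|] ->; rewrite ?tnthS//; exact: H.
Qed.

(** R^o with its Borel sigma-algebra; [measurableTypeR R] is the copy of R that
    carries the Lebesgue measure. *)
Notation Rvec R o := (o.-tuple (measurableTypeR R)).

Definition lebesgue_vec (R : realType) (o : nat) :
    {sigma_finite_measure set (Rvec R o) -> \bar R} :=
  power_measure (@lebesgue_measure R) o.

(** * Derivatives relative to a subset of the line

    Costs are only meaningful on the feasible set [Q], which may contain its
    endpoints, so difference quotients are taken inside [Q]: two-sided at
    interior points of [Q], one-sided at its endpoints. At an isolated point of
    [Q] nothing is derivable. *)

Section derivative_in.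
Context (R : realType).

Definition diff_quotient (F : R -> R) (q x : R) : R := (F x - F q) / (x - q).

Definition derivable_in (Q : set R) (F : R -> R) (q : R) : Prop :=
  limit_point Q q /\ cvg (diff_quotient F q @ within Q q^').

Definition derive_in (Q : set R) (F : R -> R) (q : R) : R :=
  lim (diff_quotient F q @ within Q q^').

Definition differentiable_in (Q : set R) (F : R -> R) : Prop :=
  forall q, Q q -> derivable_in Q F q.

End derivative_in.

(** The n-th bracket of a bisection search for a zero of a nondecreasing
    function, started from the bracket [[a, b]]. *)
Fixpoint bisection (R : realType) (F : R -> \bar R) (a b : R) (n : nat) :
    R * R :=
  if n is m.+1 then
    let I := bisection F a b m in
    let c := (I.1 + I.2) / 2 in
    if (F c <= 0)%E then (c, I.2) else (I.1, c)
  else (a, b).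

(** The integral of [h] over [A] is not of the form [+oo - +oo]. *)
Definition integral_defined d (T : measurableType d) (R : realType)
    (mu : {measure set T -> \bar R}) (A : set T) (h : T -> \bar R) : Prop :=
  (\int[mu]_(x in A) (h^\+ x) < +oo)%E \/ (\int[mu]_(x in A) (h^\- x) < +oo)%E.

Section prescriptive.
Context (R : realType) (d : measure_display) (D : measurableType d).
Variables (mu : {sigma_finite_measure set D -> \bar R}) (N o : nat).
Variables (Q : set R) (C : R -> D -> R).
Variables (Theta : set (Rvec R o)) (f : D -> Rvec R o -> R).

Local Notation Y := (N.-tuple D).
Local Notation leb := (lebesgue_vec R o).
Local Notation nu := (power_measure mu N).

Definition density_family : Prop :=
  measurable_fun ([set: D] `*` Theta) (fun p => f p.1 p.2) /\
  forall t, Theta t ->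
    (forall y, 0 <= f y t) /\ (\int[mu]_y (f y t)%:E = 1)%E.

Definition localization (u : Rvec R o -> R) : Prop :=
  [/\ measurable_fun Theta u, forall t, Theta t -> 0 <= u t
    & (\int[leb]_(t in Theta) (u t)%:E = 1)%E].

Definition joint_density (y : Y) (t : Rvec R o) : R :=
  \prod_(n < N) f (tnth y n) t.

Definition expected_cost (q : R) (t : Rvec R o) : R :=
  \int[mu]_x (C q x * f x t).

Definition maximum_likelihood (thetahat : Y -> Rvec R o) : Prop :=
  measurable_fun [set: Y] thetahat /\
  forall y, Theta (thetahat y) /\
    forall t, Theta t -> joint_density y t <= joint_density y (thetahat y).

Definition sufficient_statistic (thetahat : Y -> Rvec R o)
    (g0 : Y -> R) (g1 : Rvec R o -> Rvec R o -> R) : Prop :=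
  [/\ measurable_fun [set: Y] g0,
      measurable_fun (Theta `*` Theta) (fun p => g1 p.1 p.2),
      forall y, 0 <= g0 y,
      forall s t, Theta s -> Theta t -> 0 <= g1 s t
    & forall y t, Theta t -> joint_density y t = g0 y * g1 (thetahat y) t].

(** [kappa y] is the coordinate of [y] in its fibre, [rho] rebuilds [y] from
    [(thetahat y, kappa y)], so [kappa @` fibre] is the range of the fibre
    coordinate; it need not be the whole of [D^(N - o)]. *)
Record reparametrization (thetahat : Y -> Rvec R o)
    (kappa : Y -> (N - o).-tuple D) (rho : Rvec R o -> (N - o).-tuple D -> Y)
    (J : Rvec R o -> (N - o).-tuple D -> R) : Prop := Reparametrization {
  reparam_dim : (o <= N)%N ;
  reparam_kappa : measurable_fun [set: Y] kappa ;
  reparam_rho : measurable_fun (Theta `*` [set: (N - o).-tuple D])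
    (fun p => rho p.1 p.2) ;
  reparamK : forall y, rho (thetahat y) (kappa y) = y ;
  reparam_J : measurable_fun (Theta `*` [set: (N - o).-tuple D])
    (fun p => J p.1 p.2) ;
  reparam_J_ge0 : forall t z, Theta t -> 0 <= J t z ;
  reparam_integral : forall h : Y -> \bar R,
    measurable_fun [set: Y] h -> (forall y, 0 <= h y)%E ->
    (\int[nu]_y h y =
     \int[leb]_(t in Theta)
       \int[power_measure mu (N - o)]_(z in kappa @` (thetahat @^-1` [set t]))
         (h (rho t z) * (J t z)%:E))%E
}.

Definition prescriptive_solution (q : Y -> R) : Prop :=
  measurable_fun [set: Y] q /\ forall y, Q (q y).

(** [qbar] exhibits [q] as a function of the estimate alone. *)
Definition MLE_sufficient (thetahat : Y -> Rvec R o) (q : Y -> R)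
    (qbar : Rvec R o -> R) : Prop :=
  [/\ prescriptive_solution q, forall t, Theta t -> Q (qbar t)
    & forall y, q y = qbar (thetahat y)].

Definition performance_integrand (q : Y -> R) (u : Rvec R o -> R)
    (t : Rvec R o) (y : Y) (x : D) : R :=
  C (q y) x * f x t * joint_density y t * u t.

Definition performance (q : Y -> R) (u : Rvec R o -> R) : \bar R :=
  (\int[leb]_(t in Theta) \int[nu]_y \int[mu]_x
     (performance_integrand q u t y x)%:E)%E.

Definition locally_optimal (u : Rvec R o -> R) (q : Y -> R) : Prop :=
  prescriptive_solution q /\
  forall q', prescriptive_solution q' ->
    (performance q u <= performance q' u)%E.

(** The integrals in [performance q u] make sense and those over the parameter
    and over the data may be interchanged. *)
Definition performance_regular (q : Y -> R) (u : Rvec R o -> R) : Prop :=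
  [/\ {ae leb, forall t, Theta t -> integral_defined nu [set: Y] (fun y =>
         \int[mu]_x (performance_integrand q u t y x)%:E)%E},
      integral_defined leb Theta (fun t => \int[nu]_y \int[mu]_x
         (performance_integrand q u t y x)%:E)%E
    & (performance q u =
       \int[nu]_y \int[leb]_(t in Theta) \int[mu]_x
         (performance_integrand q u t y x)%:E)%E].

Definition beth_integrand (g1 : Rvec R o -> Rvec R o -> R) (u : Rvec R o -> R)
    (q : R) (s t : Rvec R o) : R := expected_cost q t * g1 s t * u t.

Definition beth (g1 : Rvec R o -> Rvec R o -> R) (u : Rvec R o -> R)
    (q : R) (s : Rvec R o) : R :=
  \int[leb]_(t in Theta) (beth_integrand g1 u q s t).

Definition marginal_beth (g1 : Rvec R o -> Rvec R o -> R) (u : Rvec R o -> R)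
    (q : R) (s : Rvec R o) : \bar R :=
  (\int[leb]_(t in Theta)
    (derive_in Q (fun x => expected_cost x t) q * g1 s t * u t)%:E)%E.

End prescriptive.

(* Main.v *)
(** Sufficiency factors the joint density, so exchanging the order of
    integration turns the performance of a prescriptive solution [q] into the
    integral over [y] of [g0 y * beth (q y) (thetahat y)]; as [beth] is convex in
    [q], a critical point minimizes the integrand at every [y].

    Marginal beth is the derivative of [beth]: along a segment issued from [q]
    the rescaled increments of a convex function decrease to its directional
    derivative, and monotone convergence exchanges this limit with the integral.
    A zero of this nondecreasing derivative is reached by bisection, since the
    tangent inequality shows that its signs at the two ends of the brackets pass
    to the limit. *)

Require Import Defs.
From HB Require Import structures.
From mathcomp Require Import all_boot all_order all_algebra.
From mathcomp Require Import all_classical all_reals all_analysis.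
From mathcomp Require Import measurable_realfun ring lra.

Set Implicit Arguments.
Unset Strict Implicit.
Unset Printing Implicit Defensive.

Import Order.TTheory GRing.Theory Num.Theory.
Import numFieldNormedType.Exports.

Local Open Scope classical_set_scope.
Local Open Scope ring_scope.

(** * Derivatives of convex functions relative to a convex subset of the line *)

Section convex_line.
Context (R : realType).
Implicit Types (Q : set R) (F : R -> R) (q p l : R).

(** Difference quotient at step [1/(n+1)] towards [p], not divided by [p - q]: for convex [F] it is
    then nonincreasing in [n] on either side of [q], and its term at 0 is [F p - F q]. *)
Definition radial_quotient F q p (n : nat) : R :=
  n.+1%:R * (F (q + n.+1%:R^-1 * (p - q)) - F q).

Lemma convex_set_segment Q q p l : convex_set (Q : set R^o) -> Q q -> Q p ->
  0 <= l -> l <= 1 -> Q (q + l * (p - q)).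
Proof.
move=> Qc /mem_set Qq /mem_set Qp l0 l1.
have := Qc _ _ (Itv01 l0 l1) Qp Qq; rewrite inE; congr Q.
by rewrite /conv/= /unstable.onem /GRing.scale/=; ring.
Qed.

Lemma convex_function_segment Q F q p l : convex_function (Q : set R^o) F ->
  Q q -> Q p -> 0 <= l -> l <= 1 ->
  F (q + l * (p - q)) <= F q + l * (F p - F q).
Proof.
move=> Fc /mem_set Qq /mem_set Qp l0 l1.
have := Fc (Itv01 l0 l1) _ _ Qp Qq; congr (F _ <= _).
  by rewrite /conv/= /unstable.onem /GRing.scale/=; ring.
by rewrite convRE/= /unstable.onem; ring.
Qed.

Lemma invS_le1 (n : nat) : n.+1%:R^-1 <= 1 :> R.
Proof. by rewrite invf_le1// ler1n. Qed.

(** For [m <= n] the point of index [n] lies between [q] and the point [z] of index [m], at ratio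
    [(m+1)/(n+1)]; convexity on that segment compares the two quotients. *)
Lemma radial_quotient_nonincreasing Q F q p : convex_set (Q : set R^o) ->
  convex_function (Q : set R^o) F -> Q q -> Q p ->
  nonincreasing_seq (radial_quotient F q p).
Proof.
move=> Qc Fc Qq Qp m n mn; rewrite /radial_quotient.
set z := q + m.+1%:R^-1 * (p - q).
have Qz : Q z by apply: convex_set_segment; rewrite ?invS_le1.
have ->: q + n.+1%:R^-1 * (p - q) = q + m.+1%:R / n.+1%:R * (z - q).
  by rewrite /z; field; rewrite !nat1r !pnatr_eq0.
have l1 : m.+1%:R / n.+1%:R <= 1 :> R.
  by rewrite ler_pdivrMr// mul1r ler_nat.
have := convex_function_segment Fc Qq Qz
  (divr_ge0 (ler0n R m.+1) (ler0n R n.+1)) l1.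
rewrite -lerBlDl => /(ler_wpM2l (ler0n R n.+1))/le_trans; apply.
by rewrite mulrA mulrCA divff ?mulr1// pnatr_eq0.
Qed.

(** When [p] differs from [q], the points [z n] stay in [Q], avoid [q] and tend to it, so the limit
    relative to [Q] can be taken along them. *)
Lemma cvg_radial_quotient Q F q p : convex_set (Q : set R^o) ->
  Q q -> Q p -> derivable_in Q F q ->
  radial_quotient F q p @ \oo --> (p - q) * derive_in Q F q.
Proof.
move=> Qc Qq Qp [_ dF]; have [->|pq] := eqVneq p q.
  rewrite subrr mul0r; apply: cvg_near_cst; apply: nearW => n.
  by rewrite /radial_quotient subrr mulr0 addr0 subrr mulr0.
pose z (n : nat) := q + n.+1%:R^-1 * (p - q).
have zq n : z n != q.
  by rewrite -subr_eq0 /z addrC addKr mulf_neq0 ?invr_neq0// subr_eq0.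
have cz : z @ \oo --> q.
  rewrite -[X in _ --> X]addr0 -[X in _ + X](mul0r (p - q)).
  by apply: cvgD; [exact: cvg_cst|apply: cvgMl; exact: cvg_harmonic].
have cw : z @ \oo --> within Q q^'.
  move=> A [e /= e0 eA]; have /cvgrPdist_lt/(_ _ e0) := cz.
  apply: filterS => n nz; apply: (eA _ nz) => //.
  by apply: convex_set_segment; rewrite ?invS_le1.
have -> : radial_quotient F q p = (fun n => (p - q) * diff_quotient F q (z n)).
  apply/funext => n; rewrite /radial_quotient /diff_quotient -/(z n).
  have -> : z n - q = n.+1%:R^-1 * (p - q) by rewrite /z addrC addKr.
  by field; rewrite nat1r pnatr_eq0 subr_eq0 pq.
apply: cvgMr; apply: (cvg_comp _ _ cw); exact: dF.
Qed.

(** A nonincreasing sequence lies above its limit; this is read off at index 0 of the radial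
    quotients. *)
Lemma derive_in_tangent Q F q p : convex_set (Q : set R^o) ->
  convex_function (Q : set R^o) F -> Q q -> Q p -> derivable_in Q F q ->
  (p - q) * derive_in Q F q <= F p - F q.
Proof.
move=> Qc Fc Qq Qp dF; have cr := cvg_radial_quotient Qc Qq Qp dF.
have := nonincreasing_cvgn_ge (radial_quotient_nonincreasing Qc Fc Qq Qp)
  (cvgP _ cr) 0.
by rewrite (cvg_lim _ cr)// /radial_quotient invr1 !mul1r [q + _]addrC subrK.
Qed.

(** Add the tangent inequalities at [q] and at [p]. *)
Lemma derive_in_nondecreasing Q F q p : convex_set (Q : set R^o) ->
  convex_function (Q : set R^o) F -> differentiable_in Q F ->
  Q q -> Q p -> q <= p -> derive_in Q F q <= derive_in Q F p.
Proof.
move=> Qc Fc dF Qq Qp; rewrite le_eqVlt => /predU1P[->//|qp].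
have := derive_in_tangent Qc Fc Qq Qp (dF _ Qq).
have := derive_in_tangent Qc Fc Qp Qq (dF _ Qp).
move: (derive_in Q F q) (derive_in Q F p) => x y h1 h2.
rewrite -(ler_pM2l (_ : 0 < p - q)) ?subr_gt0//; lra.
Qed.

(* The derivative of [F] need not be assumed continuous: [F] lies above its
   tangents at the points [z n], so the sign condition makes [F q] a minimum of
   [F] on the segment from [q] to [e]. *)
Lemma derive_in_sign_limit Q F q e (z : R^nat) : convex_set (Q : set R^o) ->
  convex_function (Q : set R^o) F -> differentiable_in Q F ->
  Q q -> Q e -> (forall n, Q (z n)) -> z @ \oo --> q ->
  (forall n, 0 <= (e - q) * derive_in Q F (z n)) ->
  0 <= (e - q) * derive_in Q F q.
Proof.
move=> Qc Fc dF Qq Qe Qz zq sz; have [->|eq] := eqVneq e q.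
  by rewrite subrr mul0r.
have minF l : 0 < l -> l <= 1 -> F q <= F (q + l * (e - q)).
  move=> l0 l1; set p := q + l * (e - q).
  have Qp : Q p by apply: convex_set_segment => //; exact: ltW.
  (* The tangent at [q] bounds [F (z n) - F q] below by a quantity tending to 0, which lets
     [F (z n) <= F p] pass to [F q <= F p]. *)
  have c : (z n - q) * derive_in Q F q @[n --> \oo] --> (0:R).
    rewrite -[X in _ --> X](mul0r (derive_in Q F q)); apply: cvgMl.
    by rewrite -(subrr q); apply: cvgB => //; exact: cvg_cst.
  rewrite -subr_ge0 -(cvg_lim _ c)//; apply: limr_le; first exact: cvgP c.
  have e2 : 0 < (e - q) ^+ 2 by rewrite exprn_even_gt0//= subr_eq0.
  (* The limit is positive, so eventually [p - z n] has the sign of [e - q] and the tangent at [z n]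
     does not decrease towards [p]. *)
  have c2 : (p - z n) * (e - q) @[n --> \oo] --> l * (e - q) ^+ 2.
    have -> : l * (e - q) ^+ 2 = (p - q) * (e - q) by rewrite /p; ring.
    by apply: cvgMl; apply: cvgB => //; exact: cvg_cst.
  have /(_ _) := cvgr_gt _ c2 _ (mulr_gt0 l0 e2); apply: filterS => n h.
  have t1 := derive_in_tangent Qc Fc Qq (Qz n) (dF _ Qq).
  have t2 := derive_in_tangent Qc Fc (Qz n) Qp (dF _ (Qz n)).
  apply: (le_trans t1); rewrite lerB//.
  rewrite -subr_ge0; apply: le_trans t2.
  rewrite -(pmulr_rge0 _ e2) (_ : _ ^+ 2 * _ = ((p - z n) * (e - q)) *
    ((e - q) * derive_in Q F (z n))); last by ring.
  by rewrite mulr_ge0// ltW.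
have cr := cvg_radial_quotient Qc Qq Qe (dF _ Qq).
rewrite -(cvg_lim _ cr)//; apply: limr_ge; first exact: cvgP cr.
apply: nearW => n; rewrite mulr_ge0// subr_ge0 minF ?invr_gt0//.
exact: invS_le1.
Qed.

End convex_line.

(** * Invariants and convergence of bisection *)

Section bisection.
Context (R : realType).
Implicit Types (F : R -> \bar R) (a b : R).

Lemma bisectionS F a b n (I := bisection F a b n) (c := (I.1 + I.2) / 2) :
  bisection F a b n.+1 = if (F c <= 0)%E then (c, I.2) else (I.1, c).
Proof. by []. Qed.

Lemma bisection_bounds F a b n : a <= b ->
  [/\ a <= (bisection F a b n).1,
      (bisection F a b n).1 <= (bisection F a b n).2
    & (bisection F a b n).2 <= b].
Proof.
move=> ab; elim: n => [|n [aI I12 Ib]]; first by split.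
by rewrite bisectionS; case: ifP => _ /=; split; lra.
Qed.

Lemma bisection_width F a b n :
  (bisection F a b n).2 - (bisection F a b n).1 = (b - a) / 2 ^+ n.
Proof.
elim: n => [|n IH]; first by rewrite expr0 divr1.
have -> : (b - a) / 2 ^+ n.+1 = (b - a) / 2 ^+ n / 2.
  by rewrite exprS invfM mulrA mulrAC.
by rewrite -IH bisectionS; case: ifP => _ /=; field.
Qed.

Lemma bisection_left_nondecreasing F a b : a <= b ->
  nondecreasing_seq (fun n => (bisection F a b n).1).
Proof.
move=> ab; apply/nondecreasing_seqP => n.
have [_ I12 _] := bisection_bounds F n ab.
by rewrite bisectionS; case: ifP => _ /=; lra.
Qed.

Lemma bisection_right_nonincreasing F a b : a <= b ->
  nonincreasing_seq (fun n => (bisection F a b n).2).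
Proof.
move=> ab; apply/nonincreasing_seqP => n.
have [_ I12 _] := bisection_bounds F n ab.
by rewrite bisectionS; case: ifP => _ /=; lra.
Qed.

Lemma bisection_left_le0 F a b n : (F a <= 0)%E ->
  (F (bisection F a b n).1 <= 0)%E.
Proof.
by move=> Fa; elim: n => [//|n IH]; rewrite bisectionS; case: ifP.
Qed.

Lemma bisection_right_ge0 F a b n : (0 <= F b)%E ->
  (0 <= F (bisection F a b n).2)%E.
Proof.
move=> Fb; elim: n => [//|n IH]; rewrite bisectionS; case: ifP => //=.
by move/negbT; rewrite -ltNge => /ltW.
Qed.

(** The left ends are nondecreasing and bounded by [b]; the widths [(b - a) / 2 ^+ n] tend to 0, so
    the right ends share their limit. *)
Lemma cvg_bisection F a b : a <= b -> exists q,
  [/\ a <= q, q <= b, (bisection F a b n).1 @[n --> \oo] --> q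
    & (bisection F a b n).2 @[n --> \oo] --> q].
Proof.
move=> ab; set x := fun n => (bisection F a b n).1.
have ndx : nondecreasing_seq x by exact: bisection_left_nondecreasing.
have cx : cvgn x.
  apply: nondecreasing_is_cvgn => //; exists b => _ [n _ <-].
  by have [_ I12 Ib] := bisection_bounds F n ab; exact: le_trans Ib.
exists (limn x); split => //.
- exact: (nondecreasing_cvgn_le ndx cx 0).
- apply: limr_le => //; apply: nearW => n.
  by have [_ I12 Ib] := bisection_bounds F n ab; exact: le_trans Ib.
- have -> : (fun n => (bisection F a b n).2) =
      (fun n => x n + (b - a) * (2^-1) ^+ n).
    apply/funext => n; rewrite exprVn -(bisection_width F a b n) /x.
    by rewrite addrC subrK.
  rewrite -[X in _ --> X]addr0; apply: cvgD => //.
  rewrite -[X in _ --> X](mulr0 (b - a)); apply: cvgMr.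
  by apply: cvg_expr; rewrite ger0_norm ?invr_ge0// invf_lt1// ltr1n.
Qed.

End bisection.

(** * Monotonicity and convexity of integrals *)

Section integrals.
Context d (T : measurableType d) (R : realType).
Context (m : {measure set T -> \bar R}).

(* Unlike [le_integral], no measurability is required: the integrals of the
   positive and negative parts are suprema over simple functions. *)
Lemma le_integral_pointwise (A : set T) (f g : T -> \bar R) :
  (forall x, A x -> (f x <= g x)%E) ->
  (\int[m]_(x in A) f x <= \int[m]_(x in A) g x)%E.
Proof.
move=> fg; have ge0_mono (h k : T -> \bar R) : (forall x, A x -> 0 <= h x)%E ->
    (forall x, A x -> 0 <= k x)%E -> (forall x, A x -> h x <= k x)%E ->
    (\int[m]_(x in A) h x <= \int[m]_(x in A) k x)%E.
  move=> h0 k0 hk; rewrite !ge0_integralE//; apply: le_ereal_sup.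
  move=> _ [s sh <-]; exists s => // x; apply: le_trans (sh x) _.
  by rewrite /patch; case: ifPn => // /set_mem; exact: hk.
have fg' : {in A, forall x, (f x <= g x)%E} by move=> x /set_mem; exact: fg.
rewrite integralE [leRHS]integralE leeB//; apply: ge0_mono => // x /mem_set.
- exact: funepos_le fg' x.
- exact: funeneg_le fg' x.
Qed.

Lemma convex_function_Rintegral (A : set T) (Q : set R) (G : R -> T -> R) :
  measurable A -> convex_set (Q : set R^o) ->
  (forall t, A t -> convex_function (Q : set R^o) (G^~ t)) ->
  (forall q, Q q -> m.-integrable A (EFin \o G q)) ->
  convex_function (Q : set R^o) (fun q => \int[m]_(t in A) G q t).
Proof.
move=> mA Qc Gc Gi l x y Qx Qy; rewrite convRE.
have iG z : z \in (Q : set R) -> m.-integrable A (EFin \o G z).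
  by move=> /set_mem; exact: Gi.
have iZ k z : z \in (Q : set R) ->
    m.-integrable A (EFin \o (fun t => k * G z t)).
  by move=> Qz; exact: (integrableZl mA k (iG _ Qz)).
rewrite -!RintegralZl//; try exact: iG.
rewrite -RintegralD//; try exact: iZ.
apply: le_Rintegral => //.
- by apply: iG; exact: Qc.
- exact: (integrableD mA (iZ _ _ Qx) (iZ _ _ Qy)).
- by move=> t At; have := Gc t At l x y Qx Qy; rewrite convRE.
Qed.

End integrals.

(** * Derivatives relative to a set: scaling, and exchange with an integral *)

Section derivative_in_lemmas.
Context (R : realType).
Implicit Types (Q : set R) (F : R -> R) (q c : R).

Lemma convex_functionMr Q F c : 0 <= c -> convex_function (Q : set R^o) F ->
  convex_function (Q : set R^o) (fun q => F q * c).
Proof.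
move=> c0 Fc l x y Qx Qy; have := ler_wpM2r c0 (Fc l x y Qx Qy).
by rewrite !convRE mulrDl !mulrA.
Qed.

(** [derive_in] is a [lim], and limits along this filter are unique only when it is proper. *)
Lemma within_limit_point_filter Q q : limit_point Q q ->
  ProperFilter (within Q q^').
Proof.
by move=> Qq; apply: Build_ProperFilter => /Qq[y [yq Qy]]; exact.
Qed.

Lemma derivable_inMr Q F q c : derivable_in Q F q ->
  derivable_in Q (fun x => F x * c) q /\
  derive_in Q (fun x => F x * c) q = derive_in Q F q * c.
Proof.
move=> [Qq dF]; have PF := within_limit_point_filter Qq.
have cF : diff_quotient (fun x => F x * c) q @ within Q q^' -->
    derive_in Q F q * c.
  rewrite (_ : diff_quotient _ q = (fun x => diff_quotient F q x * c)).
    by apply: cvgMl; exact: dF.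
  by apply/funext => x; rewrite /diff_quotient -mulrBl mulrAC.
by split; [split=> //; exact: cvgP cF|exact: cvg_lim cF].
Qed.

End derivative_in_lemmas.

(* Monotone convergence along a segment of [Q] needs no domination hypothesis,
   and covers the endpoints of [Q]. *)
Lemma integral_derive_in d (T : measurableType d) (R : realType)
    (m : {measure set T -> \bar R}) (A : set T) (Q : set R) (G : R -> T -> R)
    (q : R) :
  measurable A -> convex_set (Q : set R^o) ->
  (forall t, A t -> convex_function (Q : set R^o) (G^~ t)) ->
  (forall x, Q x -> m.-integrable A (EFin \o G x)) -> Q q ->
  (forall t, A t -> derivable_in Q (G^~ t) q) ->
  derivable_in Q (fun x => \int[m]_(t in A) G x t) q ->
  (\int[m]_(t in A) (derive_in Q (G^~ t) q)%:E =
   (derive_in Q (fun x => \int[m]_(t in A) G x t)%R q)%:E)%E.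
Proof.
move=> mA Qc Gc Gi Qq dG dB; set B := fun x => \int[m]_(t in A) G x t.
(* [q] is a limit point of [Q], so [Q] has another point [p]; all derivatives at [q] are computed
   along the segment towards it. *)
have [p [pq Qp _]] := dB.1 setT filterT.
pose D t := derive_in Q (G^~ t) q; pose DB := derive_in Q B q.
pose r n t := radial_quotient (G^~ t) q p n.
have Qz n : Q (q + n.+1%:R^-1 * (p - q)).
  by apply: convex_set_segment; rewrite ?invS_le1.
have iB n : m.-integrable A (EFin \o
    (fun t => G (q + n.+1%:R^-1 * (p - q)) t - G q t)).
  exact: (integrableB mA (Gi _ (Qz n)) (Gi _ Qq)).
have ir n : m.-integrable A (EFin \o r n).
  exact: (integrableZl mA _ (iB n)).
have intr n : \int[m]_(t in A) r n t = radial_quotient B q p n.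
  by rewrite /r /radial_quotient RintegralZl// RintegralB//; exact: Gi.
(* [r 0 t - r n t] is nonnegative and nondecreasing in [n], as monotone convergence requires; [k t]
   is its limit. *)
pose k t := r 0%N t - (p - q) * D t.
have cr t : A t -> r ^~ t @ \oo --> (p - q) * D t.
  by move=> At; apply: cvg_radial_quotient => //; exact: dG.
have ck t : A t -> (fun n => r 0%N t - r n t) @ \oo --> k t.
  by move=> At; apply: cvgB; [exact: cvg_cst|exact: cr].
have ih n : m.-integrable A (EFin \o (fun t => r 0%N t - r n t)).
  exact: (integrableB mA (ir 0%N) (ir n)).
have mh n : measurable_fun A (fun t => r 0%N t - r n t).
  exact/measurable_EFinP/(measurable_int _ (ih n)).
have rni t : A t -> nonincreasing_seq (r ^~ t).
  by move=> At; apply: radial_quotient_nonincreasing (Gc _ At) _ _.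
have k_ge0 t : A t -> 0 <= k t.
  move=> At; rewrite -(cvg_lim _ (ck t At))//.
  apply: limr_ge; first exact: cvgP (ck t At).
  by apply: nearW => n; rewrite subr_ge0 rni.
(* The integrals of these differences tend to the integral of [k] by monotone convergence, and to
   the right-hand side because [B] is derivable at [q]. *)
have int_k : (\int[m]_(t in A) (k t)%:E =
    (radial_quotient B q p 0 - (p - q) * DB)%:E)%E.
  have c1 := cvg_monotone_convergence (mu := m) mA
    (g' := fun n t => (r 0%N t - r n t)%:E).
  have {}c1 : (\int[m]_(t in A) (r 0%N t - r n t)%:E)%E @[n --> \oo] -->
      (\int[m]_(t in A) (k t)%:E)%E.
    rewrite (_ : (\int[m]_(t in A) (k t)%:E)%E =
        (\int[m]_(t in A) limn (fun n => (r 0%N t - r n t)%:E))%E).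
      apply: c1.
      - by move=> n; exact/measurable_EFinP.
      - by move=> n t At; rewrite lee_fin subr_ge0 rni.
      - by move=> t At a b ab; rewrite lee_fin lerB// rni.
    apply: eq_integral => t /set_mem At; apply/esym/cvg_lim => //.
    by apply: cvg_EFin; [exact: nearW|exact: ck].
  have e n : (\int[m]_(t in A) (r 0%N t - r n t)%:E)%E =
      (radial_quotient B q p 0 - radial_quotient B q p n)%:E.
    rewrite -!intr -RintegralB// /Rintegral fineK//.
    exact: integrable_fin_num (ih n).
  move: c1; rewrite (eq_cvg _ _ e) => /cvg_lim <-//; apply: cvg_lim => //.
  apply: cvg_EFin; first exact: nearW.
  by apply: cvgB; [exact: cvg_cst|exact: cvg_radial_quotient].
(* [k] is nonnegative with finite integral, hence integrable, so the integral of [r 0 - k] splits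
   below. *)
have ik : m.-integrable A (EFin \o k).
  apply/integrableP; split.
    exact/measurable_EFinP/(measurable_fun_cvg mh ck).
  rewrite (eq_integral (EFin \o k)); first by rewrite int_k ltry.
  by move=> t /set_mem At; rewrite /= ger0_norm ?k_ge0.
have Dk t : D t = (p - q)^-1 * (r 0%N t - k t).
  by rewrite /k subKr mulKf// subr_eq0.
transitivity ((p - q)^-1%:E * \int[m]_(t in A) ((r 0%N t)%:E - (k t)%:E))%E.
  transitivity (\int[m]_(t in A) ((p - q)^-1 * (r 0%N t - k t))%:E)%E.
    by apply: eq_integral => t _; rewrite -Dk.
  exact: (integralZl mA (integrableB mA (ir 0%N) ik)).
rewrite integralB_EFin// int_k -[X in (X - _)%E]fineK; last first.
  exact: integrable_fin_num (ir 0%N).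
by rewrite -/(Rintegral m A (r 0%N)) intr -EFinB -EFinM subKr mulKf// subr_eq0.
Qed.

(** * Convexity of the expected cost, and performance in terms of [beth] *)

Section prescriptive.
Context (R : realType) (d : measure_display) (D : measurableType d).
Context (mu : {sigma_finite_measure set D -> \bar R}) (N o : nat).
Context (Q : set R) (C : R -> D -> R).
Context (Theta : set (Rvec R o)) (f : D -> Rvec R o -> R).
Context (g1 : Rvec R o -> Rvec R o -> R) (u : Rvec R o -> R).
Context (Q_convex : convex_set (Q : set R^o)).
Context (phi_finite : forall q t, Q q -> Theta t ->
  mu.-integrable [set: D] (fun x => (C q x * f x t)%:E)).
Context (beth_finite : forall q s, Q q -> Theta s ->
  (lebesgue_vec R o).-integrable Theta
    (fun t => (beth_integrand mu C f g1 u q s t)%:E)).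
Context (Theta_measurable : measurable Theta).

Lemma convex_expected_cost t : (forall x, 0 <= f x t) ->
  (forall x, convex_function (Q : set R^o) (fun q => C q x)) -> Theta t ->
  convex_function (Q : set R^o) (fun q => expected_cost mu C f q t).
Proof.
move=> f0 Cc Tt; apply: (convex_function_Rintegral (G := fun q x => C q x * f x t)).
- exact: measurableT.
- exact: Q_convex.
- by move=> x _; apply: convex_functionMr => //; exact: Cc.
- by move=> q Qq; exact: phi_finite.
Qed.

Lemma performance_beth thetahat (g0 : N.-tuple D -> R) (q : N.-tuple D -> R) :
  maximum_likelihood Theta f thetahat ->
  sufficient_statistic Theta f thetahat g0 g1 ->
  prescriptive_solution Q q -> performance_regular mu C Theta f q u ->
  performance mu C Theta f q u =
  (\int[power_measure mu N]_y
     (g0 y * beth mu C Theta f g1 u (q y) (thetahat y))%:E)%E.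
Proof.
move=> [_ mle] [_ _ _ _ suff] [_ Qq] [_ _ ->].
apply: eq_integral => y _; have [Ty _] := mle y.
(* [beth] is a real integral, which defaults to 0 when the extended one is infinite; [beth_finite]
   rules this out. *)
rewrite EFinM /beth /Rintegral fineK; last first.
  by apply: integrable_fin_num => //; exact: beth_finite.
rewrite -integralZl//; last exact: beth_finite.
apply: eq_integral => t /set_mem Tt.
transitivity (\int[mu]_x ((g0 y * g1 (thetahat y) t * u t)%:E *
    (C (q y) x * f x t)%:E))%E.
  apply: eq_integral => x _.
  by rewrite -EFinM /performance_integrand suff//; congr _%:E; ring.
rewrite integralZl//; last exact: phi_finite.
rewrite -[X in (_ * X)%E]fineK; last first.
  by apply: integrable_fin_num => //; exact: phi_finite.
by rewrite -!EFinM /beth_integrand /expected_cost /Rintegral; congr _%:E; ring.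
Qed.

End prescriptive.

(** * Optimality of critical points, and zeros of [marginal_beth] by bisection *)

Theorem corollary1 (R : realType) (d : measure_display) (D : measurableType d)
    (mu : {sigma_finite_measure set D -> \bar R}) (N o : nat)
    (Q : set R) (C : R -> D -> R)
    (Theta : set (Rvec R o)) (f : D -> Rvec R o -> R)
    (thetahat : N.-tuple D -> Rvec R o)
    (g0 : N.-tuple D -> R) (g1 : Rvec R o -> Rvec R o -> R)
    (kappa : N.-tuple D -> (N - o).-tuple D)
    (rho : Rvec R o -> (N - o).-tuple D -> N.-tuple D)
    (J : Rvec R o -> (N - o).-tuple D -> R)
    (u : Rvec R o -> R)
    (Q_convex : convex_set (Q : set R^o))
    (C_measurable :
      measurable_fun (Q `*` [set: D]) (fun p : R * D => C p.1 p.2))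
    (C_convex : forall x, convex_function (Q : set R^o)
      (fun q => C q x))
    (Theta_measurable : measurable Theta)
    (f_density : density_family mu Theta f)
    (phi_finite : forall q t, Q q -> Theta t ->
      mu.-integrable [set: D] (fun x => (C q x * f x t)%:E))
    (thetahat_MLE : maximum_likelihood Theta f thetahat)
    (thetahat_sufficient : sufficient_statistic Theta f thetahat g0 g1)
    (reparam : reparametrization mu Theta thetahat kappa rho J)
    (u_localization : localization Theta u)
    (beth_finite : forall q s, Q q -> Theta s ->
      (lebesgue_vec R o).-integrable Theta
        (fun t => (beth_integrand mu C f g1 u q s t)%:E))
    (Psi_regular : forall q : N.-tuple D -> R, prescriptive_solution Q q ->
      performance_regular mu C Theta f q u)
    (beth_differentiable : forall s, Theta s ->
      differentiable_in Q (fun q => beth mu C Theta f g1 u q s)) :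
  (forall (q : N.-tuple D -> R) (q_OVP : Rvec R o -> R),
     MLE_sufficient Q Theta thetahat q q_OVP ->
     (forall s, Theta s ->
        derive_in Q (fun x => beth mu C Theta f g1 u x s) (q_OVP s) = 0) ->
     locally_optimal mu Q C Theta f u q)
  /\
  ((forall t, Theta t ->
      differentiable_in Q (fun q => expected_cost mu C f q t)) ->
   [/\ forall q_OVP : Rvec R o -> R, (forall s, Theta s -> Q (q_OVP s)) ->
         (forall s, Theta s ->
            derive_in Q (fun x => beth mu C Theta f g1 u x s) (q_OVP s) = 0)
         <->
         (forall s, Theta s ->
            marginal_beth mu Q C Theta f g1 u (q_OVP s) s = 0%E),
       forall s, Theta s -> forall q q', Q q -> Q q' -> q <= q' ->
         (marginal_beth mu Q C Theta f g1 u q s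
          <= marginal_beth mu Q C Theta f g1 u q' s)%E
     & forall s, Theta s -> forall a b, Q a -> Q b -> a <= b ->
         (marginal_beth mu Q C Theta f g1 u a s <= 0)%E ->
         (0 <= marginal_beth mu Q C Theta f g1 u b s)%E ->
         exists q,
           [/\ Q q, marginal_beth mu Q C Theta f g1 u q s = 0%E,
               (bisection (fun x => marginal_beth mu Q C Theta f g1 u x s)
                  a b n).1 @[n --> \oo] --> q
             & (bisection (fun x => marginal_beth mu Q C Theta f g1 u x s)
                  a b n).2 @[n --> \oo] --> q]]).
Proof.
(* The weights [g1 s t] and [u t] are nonnegative on [Theta], so they preserve the convexity of the
   expected cost. *)
have beth_integrand_convex s : Theta s -> forall t, Theta t ->
    convex_function (Q : set R^o) (fun q => beth_integrand mu C f g1 u q s t).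
  case: thetahat_sufficient => _ _ _ g1_ge0 _ Ts t Tt.
  case: u_localization => _ u_ge0 _; case: f_density => _ f_ge0.
  apply: convex_functionMr; first exact: u_ge0.
  apply: convex_functionMr; first exact: g1_ge0.
  exact: (convex_expected_cost Q_convex phi_finite (f_ge0 t Tt).1 C_convex Tt).
have beth_convex s : Theta s -> convex_function (Q : set R^o)
    (fun q => beth mu C Theta f g1 u q s).
  move=> Ts; exact: (convex_function_Rintegral Theta_measurable Q_convex
    (beth_integrand_convex s Ts) (fun q Qq => beth_finite q s Qq Ts)).
split.
  move=> q q_OVP [q_sol Qq_OVP qE] crit; split=> [|q' q'_sol]; first exact: q_sol.
  have psiE p (p_sol : prescriptive_solution Q p) := performance_beth phi_finite
    beth_finite Theta_measurable thetahat_MLE thetahat_sufficient p_sol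
    (Psi_regular p p_sol).
  rewrite (psiE q q_sol) (psiE q' q'_sol).
  case: thetahat_MLE => _ mle; case: thetahat_sufficient => _ _ g0_ge0 _ _.
  (* The comparison is made at each [y] separately, so the competitor [q'] may depend on all of [y];
     [g0 y >= 0] keeps the direction of the inequality. *)
  apply: le_integral_pointwise => y _; rewrite lee_fin ler_wpM2l// qE.
  have [Ts _] := mle y; have := crit _ Ts; have := Qq_OVP _ Ts.
  move: (thetahat y) Ts => s Ts Qs crits.
  (* With zero slope, the tangent inequality says that [q_OVP s] minimizes [beth] over [Q]. *)
  have := derive_in_tangent Q_convex (beth_convex _ Ts) Qs (q'_sol.2 y)
    (beth_differentiable _ Ts _ Qs).
  by rewrite crits mulr0 subr_ge0.
move=> phi_differentiable.
have weight_scale s q t : Theta s -> Theta t -> Q q ->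
    derivable_in Q (fun x => beth_integrand mu C f g1 u x s t) q /\
    derive_in Q (fun x => beth_integrand mu C f g1 u x s t) q =
    derive_in Q (fun x => expected_cost mu C f x t) q * g1 s t * u t.
  move=> Ts Tt Qq.
  have [dg <-] := derivable_inMr (g1 s t) (phi_differentiable t Tt q Qq).
  exact: derivable_inMr.
(* On [Q], [marginal_beth] is thus finite and is the derivative of the convex function [beth],
   whence the equivalence and the monotonicity. *)
have marginalE s q : Theta s -> Q q -> marginal_beth mu Q C Theta f g1 u q s =
    (derive_in Q (fun x => beth mu C Theta f g1 u x s) q)%:E.
  move=> Ts Qq; rewrite -(integral_derive_in Theta_measurable Q_convex
    (beth_integrand_convex s Ts) (fun x Qx => beth_finite x s Qx Ts) Qq
    (fun t Tt => (weight_scale s q t Ts Tt Qq).1)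
    (beth_differentiable s Ts q Qq)).
  by apply: eq_integral => t /set_mem Tt; rewrite (weight_scale s q t Ts Tt Qq).2.
split.
- move=> q_OVP Qq; split=> crit s Ts; have := crit s Ts.
    by rewrite marginalE ?crit//; exact: Qq.
  by rewrite marginalE//; [case|exact: Qq].
- move=> s Ts q q' Qq Qq' qq'; rewrite !marginalE// lee_fin.
  exact: (derive_in_nondecreasing Q_convex (beth_convex s Ts)
    (beth_differentiable s Ts)).
move=> s Ts a b Qa Qb ab; set M := fun x => marginal_beth mu Q C Theta f g1 u x s.
move=> Ma Mb; have [q [aq qb cl cr]] := cvg_bisection M ab.
(* A convex subset of the line contains the interval between two of its points; [a = b] is set apart
   because the ratio divides by [b - a]. *)
have Q_itv x : a <= x -> x <= b -> Q x.
  move=> ax xb; have [ba|ba] := eqVneq b a.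
    by rewrite (_ : x = a)//; apply/eqP; rewrite eq_le ax -ba xb.
  have lt_ab : 0 < b - a by rewrite subr_gt0 lt_neqAle eq_sym ba.
  have -> : x = a + (x - a) / (b - a) * (b - a).
    by rewrite divfK ?gt_eqF// addrC subrK.
  apply: convex_set_segment => //; first by rewrite divr_ge0 ?subr_ge0.
  by rewrite ler_pdivrMr// mul1r lerB.
have Ql n : Q (bisection M a b n).1.
  by have [h1 h2 h3] := bisection_bounds M n ab; apply: Q_itv => //; exact: le_trans h3.
have Qr n : Q (bisection M a b n).2.
  by have [h1 h2 h3] := bisection_bounds M n ab; apply: Q_itv => //; exact: le_trans h2.
have Qq : Q q by exact: Q_itv.
have dB := beth_differentiable s Ts; have Bc := beth_convex s Ts.
exists q; split => //; rewrite marginalE//; congr _%:E; apply/eqP.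
rewrite eq_le; apply/andP; split.
(* If [q = a] the sign is the hypothesis [Ma]. Otherwise [a - q < 0] turns the signs at the left
   ends into the premise of [derive_in_sign_limit] with [e := a]; the right ends serve in the same
   way with [e := b]. *)
- have [<-|qa] := eqVneq a q; first by rewrite -lee_fin -marginalE.
  have qa' : a - q < 0 by rewrite subr_lt0 lt_neqAle qa.
  rewrite -(nmulr_rge0 _ qa').
  apply: (derive_in_sign_limit Q_convex Bc dB Qq Qa Ql cl) => n.
  rewrite (nmulr_rge0 _ qa') -lee_fin -(marginalE s _ Ts (Ql n)).
  exact: (bisection_left_le0 (F := M) b n Ma).
- have [->|qb'] := eqVneq q b; first by rewrite -lee_fin -marginalE.
  have bq : 0 < b - q by rewrite subr_gt0 lt_neqAle qb'.
  rewrite -(pmulr_rge0 _ bq).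
  apply: (derive_in_sign_limit Q_convex Bc dB Qq Qb Qr cr) => n.
  rewrite (pmulr_rge0 _ bq) -lee_fin -(marginalE s _ Ts (Qr n)).
  exact: (bisection_right_ge0 (F := M) a n Mb).
Qed.
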